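(* Index the coordinates of $\{0,1,2\}^m$ by $\{0,1,\dots,m-1\}$ and write a subset such as $\{0,1,3,4\}$ as $0134$. Then: (i) in $\{0,1,2\}^5$, the sets $0134, 0234, 1234$ form a type $11$ clash; (ii) in $\{0,1,2\}^5$, the sets $0124, 0134, 0234$ form a type $211$ clash; (iii) in $\{0,1,2\}^5$, the sets $0123, 0124, 0134$ form a type $1211$ clash; (iv) in $\{0,1,2\}^6$, the sets $0123, 0145, 2345$ form a type $1212$ clash.
   Context: For $v\in\{0,1,2\}^m$, the support of $v$ is the set of indices of its non-zero coordinates; $V_S$ is the set of vectors with support exactly $S$. Three vectors $v_1,v_2,v_3$ form a clash if there is no coordinate at which exactly one of them is non-zero and no coordinate at which their three values are pairwise distinct. For $t\in\{1,2\}^k$, a vector $v$ is of type $t$ if $v$ has at least $k$ non-zero coordinates and, for each $i\le k$, the $i$-th non-zero coordinate of $v$ (in increasing order of index) equals $t_i$. Sets $S_1,S_2,S_3$ of coordinates, each of size $w$, form a type $t$ clash if whenever $v_1\in V_{S_1}$, $v_2\in V_{S_2}$, $v_3\in V_{S_3}$ are all of type $t$, the triple $\{v_1,v_2,v_3\}$ is a clash. *)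

(* Defs.v *)
From mathcomp Require Import all_boot.

Set Implicit Arguments.
Unset Strict Implicit.
Unset Printing Implicit Defensive.

Definition vec (m : nat) := {ffun 'I_m -> 'I_3}.

Definition supp (m : nat) (v : vec m) : {set 'I_m} := [set i | v i != ord0].

Definition V (m : nat) (S : {set 'I_m}) : {set vec m} := [set v | supp v == S].

Definition clash (m : nat) (v1 v2 v3 : vec m) : Prop :=
  forall i : 'I_m,
    count (fun v : vec m => v i != ord0) [:: v1; v2; v3] != 1 /\
    ~~ uniq [:: v1 i; v2 i; v3 i].

(* The alphabet {1,2} of the entries of a type. *)
Definition nonzero := {x : 'I_3 | x != ord0}.
Definition sym1 : nonzero := exist _ (Ordinal (isT : 1 < 3)) isT.
Definition sym2 : nonzero := exist _ (Ordinal (isT : 2 < 3)) isT.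

(* [enum] lists a subset of ['I_m] in increasing order, so this is the sequence
   of the values of v at its non-zero coordinates, by increasing index. *)
Definition nonzero_values (m : nat) (v : vec m) : seq 'I_3 :=
  [seq v i | i <- enum (supp v)].

Definition of_type (m k : nat) (t : k.-tuple nonzero) (v : vec m) : Prop :=
  k <= #|supp v| /\
  forall i : 'I_k, nth ord0 (nonzero_values v) i = val (tnth t i).

Definition type_clash (m w k : nat) (t : k.-tuple nonzero)
    (S1 S2 S3 : {set 'I_m}) : Prop :=
  [/\ #|S1| = w, #|S2| = w, #|S3| = w &
    forall v1 v2 v3 : vec m, v1 \in V S1 -> v2 \in V S2 -> v3 \in V S3 ->
      of_type t v1 -> of_type t v2 -> of_type t v3 -> clash v1 v2 v3].

Definition coords (m : nat) (s : seq nat) : {set 'I_m} :=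
  [set i : 'I_m | val i \in s].

(* Main.v *)
(** Once the supports and the type are fixed, each coordinate of a vector takes
    its value in an explicit list of one or two possible values. Whether three
    vectors clash is decided coordinate by coordinate, so a type clash follows
    from a finite check on these lists. *)

Require Import Defs.
From mathcomp Require Import all_boot.

Set Implicit Arguments.
Unset Strict Implicit.
Unset Printing Implicit Defensive.

(** Two strictly increasing sequences with the same members are equal. Hence the rank of a
    coordinate in the support is its [index] in [s]. *)
Lemma enum_coords (m : nat) (s : seq nat) :
  sorted ltn s -> all (gtn m) s -> [seq val i | i <- enum (coords m s)] = s.
Proof.
move=> s_sorted s_lt.
apply: (irr_sorted_eq ltn_trans ltnn) => //.
  rewrite sorted_map; apply: sorted_filter => [x y z /=|]; first exact: ltn_trans.
  by rewrite -enumT -(sorted_map (e' := ltn)) val_enum_ord iota_ltn_sorted.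
move=> x; apply/mapP/idP => [[i] | xs].
  by rewrite mem_enum inE => ? ->.
by exists (Ordinal (allP s_lt _ xs)); rewrite ?mem_enum ?inE.
Qed.

(** When [s] lists the support increasingly, [index j s] is the rank of [j] counted from 0, so the
    type prescribes the value at [j] when it is longer than this rank. Plain naturals are used so
    that the final check reduces by computation. *)
Definition entries (t s : seq nat) (j : nat) : seq nat :=
  if j \notin s then [:: 0]
  else if index j s < size t then [:: nth 0 t (index j s)] else [:: 1; 2].

Lemma mem_entries (m k : nat) (t : k.-tuple nonzero) (s : seq nat) (v : vec m) :
  sorted ltn s -> all (gtn m) s -> v \in V (coords m s) -> of_type t v ->
  forall i : 'I_m, val (v i) \in entries [seq val (val a) | a <- t] s i.
Proof.
move=> s_sorted s_lt; rewrite inE => /eqP suppv [_ vt] i.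
have vi0 : (v i != ord0) = (val i \in s).
  by have /setP/(_ i) := suppv; rewrite !inE.
rewrite /entries size_map size_tuple -vi0.
case: (eqVneq (v i) ord0) => [-> // | vi_neq0] /=.
case: ltnP => [lt_k | _]; last first.
  (* Past the end of the type, a non-zero value can be 1 or 2. *)
  by move: vi_neq0; case: (v i) => [[|[|[|]]]].
have is_s : val i \in s by rewrite -vi0.
have es := enum_coords s_sorted s_lt.
have := vt (Ordinal lt_k); rewrite /nonzero_values suppv (tnth_nth sym1) /=.
rewrite (nth_map i) /=; last by rewrite -(size_map val) es index_mem.
(* The first [i] is only the default of [nth]; the rank of [i] is in range. *)
have -> : nth i (enum (coords m s)) (index (val i) s) = i.
  apply: val_inj; rewrite -(nth_map i (val i) val) ?es ?nth_index //.
  by rewrite -(size_map val) es index_mem.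
by move=> ->; rewrite (nth_map sym1) ?size_tuple // inE.
Qed.

Definition no_obstruction (x y z : nat) : bool :=
  (count (fun a => a != 0) [:: x; y; z] != 1) && ~~ uniq [:: x; y; z].

(** Being a clash constrains each coordinate separately, so testing all triples of entries at each
    [j] covers all triples of vectors. *)
Definition clash_check (m : nat) (t s1 s2 s3 : seq nat) : bool :=
  all (fun j => all (fun x => all (fun y => all (no_obstruction x y)
    (entries t s3 j)) (entries t s2 j)) (entries t s1 j)) (iota 0 m).

Definition is_support (m w : nat) (s : seq nat) : bool :=
  [&& sorted ltn s, all (gtn m) s & size s == w].

Lemma type_clash_check (m w k : nat) (t : k.-tuple nonzero) (s1 s2 s3 : seq nat) :
  all (is_support m w) [:: s1; s2; s3] ->
  clash_check m [seq val (val a) | a <- t] s1 s2 s3 ->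
  type_clash w t (coords m s1) (coords m s2) (coords m s3).
Proof.
have card s : is_support m w s -> #|coords m s| = w.
  case/and3P=> ss sl /eqP <-.
  by rewrite cardE -(size_map val) enum_coords.
case/and4P=> S1 S2 S3 _ /allP chk; split; try exact: card.
case/and3P: S1 S2 S3 => ? ? _ /and3P[? ? _] /and3P[? ? _].
move=> v1 v2 v3 V1 V2 V3 T1 T2 T3 i.
have := chk i; rewrite mem_iota ltn_ord => /(_ isT).
move=> /allP/(_ (v1 i)); rewrite mem_entries // => /(_ isT).
move=> /allP/(_ (v2 i)); rewrite mem_entries // => /(_ isT).
move=> /allP/(_ (v3 i)); rewrite mem_entries // => /(_ isT).
by case/andP.
Qed.

Theorem theorem3 :
  [/\ type_clash 4 [tuple sym1; sym1]
        (coords 5 [:: 0; 1; 3; 4]) (coords 5 [:: 0; 2; 3; 4])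
        (coords 5 [:: 1; 2; 3; 4]),
      type_clash 4 [tuple sym2; sym1; sym1]
        (coords 5 [:: 0; 1; 2; 4]) (coords 5 [:: 0; 1; 3; 4])
        (coords 5 [:: 0; 2; 3; 4]),
      type_clash 4 [tuple sym1; sym2; sym1; sym1]
        (coords 5 [:: 0; 1; 2; 3]) (coords 5 [:: 0; 1; 2; 4])
        (coords 5 [:: 0; 1; 3; 4]) &
      type_clash 4 [tuple sym1; sym2; sym1; sym2]
        (coords 6 [:: 0; 1; 2; 3]) (coords 6 [:: 0; 1; 4; 5])
        (coords 6 [:: 2; 3; 4; 5])].
(* The remaining premises are closed booleans that evaluate to [true]. *)
Proof. by split; apply: type_clash_check. Qed.
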